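(* Let $q$ be a prime power and $n\geq 2$ an integer. Let $W$ and $Y=\{\gamma_j:0\leq j\leq n-1\}$ be any two bases for $\mathbb{F}_{q^n}$ over $\mathbb{F}_q$. Let $B=\{\beta_j:0\leq j\leq n-1\}$ be the dual basis of $W$. Let $\widetilde g=(g_0,\dots,g_{n-1})$ be any vector-valued polynomial, with $g_0,\dots,g_{n-1}\in\mathbb{F}_q[x_0,\dots,x_{n-1}]$, such that $\overline g=(g_0:\dots:g_{n-1})$ is a bijection over $\mathrm{PG}(n-1,q)$. Let $r\in\mathbb{N}$ be coprime to $q-1$. For $0\leq j\leq n-1$ and each $x\in\mathbb{F}_{q^n}^\ast$ such that $j=\max\{0\leq i\leq n-1:\mathrm{Tr}_q^{q^n}(\beta_ix)\neq 0\}$, define $$f_j(x)=\mathrm{Tr}_q^{q^n}(\beta_jx)^r\sum_{k=0}^{n-1}g_k\Biggl(\frac{\mathrm{Tr}_q^{q^n}(\beta_0x)}{\mathrm{Tr}_q^{q^n}(\beta_jx)},\dots,\frac{\mathrm{Tr}_q^{q^n}(\beta_{j-1}x)}{\mathrm{Tr}_q^{q^n}(\beta_jx)},1,0,\dots,0\Biggr)\gamma_k.$$ Define $f:\mathbb{F}_{q^n}\to\mathbb{F}_{q^n}$, where $$f(x)=\begin{cases}0&\text{if }x=0;\\ f_j(x)&\text{if }j=\max\{0\leq i\leq n-1:\mathrm{Tr}_q^{q^n}(\beta_ix)\neq 0\}\quad(0\leq j\leq n-1).\end{cases}$$ Then $f$ is an $r$-homogeneous rational mapping which permutes $\mathbb{F}_{q^n}$.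 In particular, if $r\geq\max\{\deg(g_k):0\leq k\leq n-1\}$, then $f$ is an $r$-homogeneous permutation polynomial of index $\frac{q^n-1}{q-1}$ over $\mathbb{F}_{q^n}$.
   Context: $\mathrm{PG}(n-1,q)=(\mathbb{F}_q^n\setminus\{\vec 0\})/\sim$, where $\vec x\sim\vec y$ iff $\vec x=\lambda\vec y$ for some $\lambda\in\mathbb{F}_q^\ast$; the class of $(x_0,\dots,x_{n-1})$ is written $(x_0:\dots:x_{n-1})$. The map $\overline g$ sends $(x_0:\dots:x_{n-1})$ to $(g_0(x_0,\dots,x_{n-1}):\dots:g_{n-1}(x_0,\dots,x_{n-1}))$; in particular it is assumed to be well defined (the $g_k$ have no common zero in $\mathbb{F}_q^n\setminus\{\vec 0\}$, and proportional nonzero inputs have proportional outputs). $\mathrm{Tr}_q^{q^n}$ is the trace from $\mathbb{F}_{q^n}$ to $\mathbb{F}_q$. The dual basis of $W=\{\omega_j\}$ is the basis with $\mathrm{Tr}_q^{q^n}(\beta_i\omega_j)=1$ if $i=j$ and $0$ otherwise. A map ''permutes'' a set if it is a bijection of the set to itself. A map $f$ on $\mathbb{F}_{q^n}$ is $r$-homogeneous if $f(\lambda x)=\lambda^rf(x)$ for all $\lambda\in\mathbb{F}_q$ and $x\in\mathbb{F}_{q^n}$. ''Rational mapping'' means given piecewise, on the sets where $\max\{i:\mathrm{Tr}_q^{q^n}(\beta_ix)\neq 0\}=j$, by rational expressions in $x$. A permutation polynomial (here with the given $r$) of index $\frac{q^n-1}{q-1}$ over $\mathbb{F}_{q^n}$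 means a permutation of $\mathbb{F}_{q^n}$ of the form $f(x)=x^rh(x^{q-1})$ for all $x\in\mathbb{F}_{q^n}$, with $h\in\mathbb{F}_{q^n}[x]$. *)

(* Defs.v *)
From HB Require Import structures.
From mathcomp Require Import all_boot all_order all_algebra all_fingroup all_solvable all_field.
From mathcomp Require Import generic_quotient mpoly.

Set Implicit Arguments.
Unset Strict Implicit.
Unset Printing Implicit Defensive.

Import GRing.Theory.
Local Open Scope ring_scope.
Local Open Scope quotient_scope.

(* PG(n-1, F): nonzero vectors of F^n modulo nonzero scalars. *)
Section ProjectiveSpace.
Variables (F : finFieldType) (n : nat).

Definition nzvec := {v : 'rV[F]_n | v != 0}.

Definition proportional (u v : nzvec) : bool :=
  [exists c : F, (c != 0) && (val u == c *: val v)].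

Lemma proportional_refl : reflexive proportional.
Proof. by move=> u; apply/existsP; exists 1; rewrite oner_eq0 scale1r eqxx. Qed.

Lemma proportional_sym : ssrbool.symmetric proportional.
Proof.
suff imp u v : proportional u v -> proportional v u.
  by move=> u v; apply/idP/idP; apply: imp.
case/existsP=> c /andP[nzc /eqP def_u]; apply/existsP; exists c^-1.
by rewrite invr_eq0 nzc def_u scalerA mulVf // scale1r eqxx.
Qed.

Lemma proportional_trans : transitive proportional.
Proof.
move=> v u w /existsP[c /andP[nzc /eqP def_u]] /existsP[d /andP[nzd /eqP def_v]].
apply/existsP; exists (c * d).
by rewrite mulf_neq0 //= def_u def_v scalerA.
Qed.

Canonical proportional_equiv :=
  EquivRel proportional proportional_refl proportional_sym proportional_trans.

Definition PG := {eq_quot proportional}.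

Definition eval_vec (g : 'I_n -> {mpoly F[n]}) (v : 'rV[F]_n) : 'rV[F]_n :=
  \row_k (g k).@[fun i => v 0 i].

(* [gbar] is the map (x_0 : ... : x_(n-1)) |-> (g_0(x) : ... : g_(n-1)(x)).
   The existence of such a [gbar] says exactly that this map is well defined:
   the g_k have no common nonzero root, and proportional nonzero vectors have
   proportional images; [gbar] is then unique. *)
Definition induces (g : 'I_n -> {mpoly F[n]}) (gbar : PG -> PG) : Prop :=
  forall v : nzvec, exists2 w : nzvec,
    val w = eval_vec g (val v) & gbar (\pi_PG v) = \pi_PG w.

End ProjectiveSpace.

(* Every finite extension of a finite field is a splitting field, so that
   [splittingFieldType F] is no restriction on the extension [L]. *)
Section FiniteFieldMaps.
Variables (F : finFieldType) (L : splittingFieldType F).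

(* The library's [galTrace] takes its values in the copy [1%VS] of F inside L;
   taking the coordinate on 1 gives the value in F, cf. [FtraceE]. *)
Definition Ftrace (x : L) : F :=
  coord [tuple (1 : L)] ord0 (galTrace 1 {:L} x).

Lemma FtraceE (x : L) : (Ftrace x)%:A = galTrace 1 {:L} x.
Proof.
have Tr_x : galTrace 1 {:L} x \in <<[tuple (1%R : L)]>>%VS.
  rewrite span_seq1 mem_galTrace ?memvf //.
  exact: finField_galois (sub1v _).
by rewrite [RHS](coord_span Tr_x) big_ord1.
Qed.

Lemma Ftrace_Frobenius (x : L) :
  (Ftrace x)%:A = \sum_(i < \dim {:L}) x ^+ (#|F| ^ i).
Proof.
have s1L: (1 <= {:L})%VS by apply: sub1v.
have [a /eqP defG Da] := finField_galois_generator s1L.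
have oa : \dim {:L} = #[a]%g.
  by rewrite orderE -defG -(galois_dim (finField_galois s1L)) dimv1 divn1.
have imG : 'Gal({:L} / 1)%g = [set (a ^+ (i : nat))%g | i : 'I_#[a]%g].
  apply/setP=> b; rewrite defG.
  apply/idP/imsetP => [/cyclePmin[i lt_i ->] | [i _ ->]]; last exact: mem_cycle.
  by exists (Ordinal lt_i).
rewrite FtraceE /galTrace imG big_imset /= => [|i j _ _ /eqP]; last first.
  by rewrite eq_expg_mod_order !modn_small // => /eqP/val_inj.
rewrite oa; apply: eq_bigr => i _; elim: (nat_of_ord i) => [|m IHm].
  by rewrite expg0 gal_id expn0.
by rewrite expgSr galM ?memvf // IHm Da ?memvf //= dimv1 expn1 expnSr exprM.
Qed.

Section Indexed.
Variable n : nat.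
Implicit Types (W B Y : n.-tuple L) (g : 'I_n -> {mpoly F[n]}).

Definition dual_basis W B : Prop :=
  basis_of {:L} B /\
  forall i j : 'I_n, Ftrace (tnth B i * tnth W j) = (i == j)%:R.

(* j = max {i | Tr(beta_i x) != 0} *)
Definition is_top B (x : L) (j : 'I_n) : bool :=
  (Ftrace (tnth B j * x) != 0) &&
  [forall i : 'I_n, (Ftrace (tnth B i * x) != 0) ==> (i <= j)%N].

(* (Tr(beta_0 x) / Tr(beta_j x), ..., Tr(beta_(j-1) x) / Tr(beta_j x),
    1, 0, ..., 0), with the 1 in position j *)
Definition normalized B (j : 'I_n) (x : L) : 'rV[F]_n :=
  \row_(i < n)
    if (i < j)%N then Ftrace (tnth B i * x) / Ftrace (tnth B j * x)
    else if i == j then 1 else 0.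

Definition f_piece B Y g (r : nat) (j : 'I_n) (x : L) : L :=
  Ftrace (tnth B j * x) ^+ r *:
    \sum_(k < n) eval_vec g (normalized B j x) 0 k *: tnth Y k.

(* The last [0] is never reached when B is a basis: every nonzero x then has
   a (unique) j such that [is_top B x j]. *)
Definition f_map B Y g (r : nat) (x : L) : L :=
  if x == 0 then 0
  else if [pick j | is_top B x j] is Some j then f_piece B Y g r j x
  else 0.

Definition rational_mapping B (f : L -> L) : Prop :=
  forall j : 'I_n, exists P Q : {poly L},
    forall x : L, is_top B x j -> Q.[x] != 0 /\ f x = P.[x] / Q.[x].

End Indexed.

Definition homogeneous_map (r : nat) (f : L -> L) : Prop :=
  forall (c : F) (x : L), f (c *: x) = c ^+ r *: f x.

(* A permutation x^r h(x^(q-1)) of L, with q = #|F|; its index is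
   (#|L| - 1) / (q - 1). *)
Definition index_perm_poly (r : nat) (f : L -> L) : Prop :=
  bijective f /\
  exists h : {poly L}, forall x : L, f x = x ^+ r * h.[x ^+ (#|F| - 1)].

End FiniteFieldMaps.

(* Main.v *)
(* In the coordinates v of x on W, i.e. the traces of the beta_i x, f sends v
   to v_j^r g(v / v_j), read on the basis Y, with j the last nonzero
   coordinate. If f x = f y then gbar agrees on the points of PG(n-1, q) of x
   and y, so their normalized vectors are equal; as g does not vanish there,
   the r-th powers of the last nonzero coordinates agree, and r is coprime to
   q - 1. Since f is r-homogeneous, f(x) / x^r depends only on x^(q-1), as
   x^(q-1) = y^(q-1) exactly when x and y are proportional over F; hence it is
   interpolated by a polynomial in x^(q-1), whatever the degrees of the g_k. *)
Require Import Defs.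
From HB Require Import structures.
From mathcomp Require Import all_boot all_order all_algebra all_fingroup all_solvable all_field.
From mathcomp Require Import generic_quotient mpoly.

Set Implicit Arguments.
Unset Strict Implicit.
Unset Printing Implicit Defensive.

Import GRing.Theory.
Local Open Scope ring_scope.

(** * Interpolation, and power maps on a finite field *)

Lemma poly_interpolation (T : eqType) (K : fieldType) (s : seq T) (u w : T -> K) :
    {in s &, forall x y, u x = u y -> w x = w y} ->
  exists p : {poly K}, {in s, forall x, p.[u x] = w x}.
Proof.
elim: s => [|a s IHs] w_u; first by exists 0.
have [|p Dp] := IHs.
  by move=> x y sx sy; apply: w_u; rewrite inE ?sx ?sy orbT.
(* If the node [u a] already occurs, the compatibility hypothesis makes [p] correct there. *)
have [/mapP[b sb Dua] | s'ua] := boolP (u a \in map u s).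
  exists p => x /[!inE] /predU1P[-> | /Dp//].
  by rewrite Dua Dp //; apply: w_u; rewrite ?mem_head // inE sb orbT.
(* Newton's correction: [m] vanishes at all earlier nodes but not at [u a]. *)
pose m := \prod_(z <- map u s) ('X - z%:P).
have nz_m: m.[u a] != 0 by rewrite -[_ == 0]/(root m _) root_prod_XsubC.
exists (p + ((w a - p.[u a]) / m.[u a]) *: m) => x /[!inE].
rewrite hornerD hornerZ => /predU1P[-> | sx]; first by rewrite divfK // addrC subrK.
have /eqP->: root m (u x) by rewrite root_prod_XsubC map_f.
by rewrite mulr0 addr0 Dp.
Qed.

(** By Bezout r has an inverse k modulo q - 1, the exponent of the multiplicative group of [F], so
    the k-th power undoes the r-th power. *)
Lemma expf_coprime_inj (F : finFieldType) (r : nat) (a b : F) :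
    (0 < r)%N -> coprime r (#|F| - 1) -> a != 0 -> b != 0 ->
  a ^+ r = b ^+ r -> a = b.
Proof.
move=> r_gt0 /(coprimeP _ r_gt0)[[k l] /= Dkl] nz_a nz_b eq_r.
have F1 (c : F) : c != 0 -> c ^+ (#|F| - 1) = 1.
  move=> nz_c; apply: (mulfI nz_c).
  by rewrite -exprS mulr1 subn1 prednK ?expf_card // ltnW ?finNzRing_gt1.
have Er (c : F) : c != 0 -> c = (c ^+ r) ^+ k.
  move=> nz_c; rewrite -exprM mulnC.
  have ->: (k * r = 1 + l * (#|F| - 1))%N by rewrite -[X in (X + _)%N]Dkl subnK // ltnW // -subn_gt0 Dkl.
  by rewrite exprD expr1 mulnC exprM F1 // expr1n mulr1.
by rewrite (Er a) // eq_r -Er.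
Qed.

(** * Trace coordinates and injectivity of f *)

Section Trace.
Local Open Scope quotient_scope.
Variables (F : finFieldType) (L : splittingFieldType F).

Lemma FtraceZ c (x : L) : Ftrace (c *: x) = c * Ftrace x.
Proof.
rewrite /Ftrace -[RHS]linearZ /=; congr (coord _ _ _).
by rewrite /galTrace scaler_sumr; apply: eq_bigr => s _; rewrite linearZ.
Qed.

Lemma Ftrace_sum (I : finType) (E : I -> L) : Ftrace (\sum_i E i) = \sum_i Ftrace (E i).
Proof.
rewrite /Ftrace -linear_sum /=; congr (coord _ _ _).
rewrite /galTrace exchange_big /=.
by apply: eq_bigr => s _; rewrite linear_sum.
Qed.

Variable n : nat.
Implicit Types (W B Y : n.-tuple L) (g : 'I_n -> {mpoly F[n]}).

Definition trace_coords B (x : L) : 'rV[F]_n := \row_i Ftrace (tnth B i * x).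

Lemma trace_coordsZ B c x : trace_coords B (c *: x) = c *: trace_coords B x.
Proof. by apply/rowP=> i; rewrite !mxE -scalerAr FtraceZ. Qed.

(** Expand x on [W]: multiplying by the i-th element of [B] and taking the trace leaves only the
    i-th coefficient. *)
Lemma dual_basis_sum W B x : basis_of {:L} W -> dual_basis W B ->
  x = \sum_i trace_coords B x 0 i *: tnth W i.
Proof.
move=> W_basis [_ B_dual].
rewrite {1}(coord_basis W_basis (memvf x)); apply: eq_bigr => i _.
rewrite -tnth_nth; congr (_ *: _).
rewrite mxE [x in RHS](coord_basis W_basis (memvf x)) mulr_sumr Ftrace_sum.
rewrite (bigD1 i) //= big1 => [|k /negPf i'k];
  rewrite -tnth_nth -scalerAr FtraceZ B_dual.
  by rewrite eqxx mulr1 addr0.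
by rewrite eq_sym i'k mulr0.
Qed.

Lemma trace_coords_inj W B : basis_of {:L} W -> dual_basis W B ->
  injective (trace_coords B).
Proof.
move=> W_basis B_dual x y eq_xy.
by rewrite (dual_basis_sum x W_basis B_dual) eq_xy -dual_basis_sum.
Qed.

Lemma trace_coords_neq0 W B x : basis_of {:L} W -> dual_basis W B ->
  x != 0 -> trace_coords B x != 0.
Proof.
move=> W_basis B_dual; apply: contra_neq => x0.
apply: (trace_coords_inj W_basis B_dual).
by rewrite x0 -[X in trace_coords B X](scale0r 0) trace_coordsZ scale0r.
Qed.

Lemma is_top_exists B x : trace_coords B x != 0 -> exists j, is_top B x j.
Proof.
case/rV0Pn=> i0; rewrite mxE => nz_i0.
case: (@arg_maxnP _ i0 (fun i => Ftrace (tnth B i * x) != 0) val nz_i0) => j nz_j max_j.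
by exists j; rewrite /is_top nz_j; apply/forallP=> i; apply/implyP/max_j.
Qed.

Lemma is_top_inj B x i j : is_top B x i -> is_top B x j -> i = j.
Proof.
case/andP=> nz_i /forallP max_i /andP[nz_j /forallP max_j].
by apply/val_inj/anti_leq; rewrite (implyP (max_j i)) ?(implyP (max_i j)).
Qed.

Lemma is_topZ B c x j : c != 0 -> is_top B (c *: x) j = is_top B x j.
Proof.
move=> nz_c; have nzE i :
    (Ftrace (tnth B i * (c *: x)) != 0) = (Ftrace (tnth B i * x) != 0).
  by rewrite -scalerAr FtraceZ mulf_eq0 negb_or nz_c.
by rewrite /is_top nzE; congr (_ && _); apply: eq_forallb => i; rewrite nzE.
Qed.

Lemma is_top_neq0 B x j : is_top B x j -> trace_coords B x 0 j != 0.
Proof. by case/andP; rewrite mxE. Qed.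

(** Coordinates beyond the top index j vanish, so the padding by zeros agrees with plain rescaling.
    This turns the case split into a scalar multiple of the coordinate vector. *)
Lemma normalizedE B x j : is_top B x j ->
  normalized B j x = (trace_coords B x 0 j)^-1 *: trace_coords B x.
Proof.
case/andP=> nz_j /forallP max_j; apply/rowP=> i; rewrite !mxE [RHS]mulrC.
case: ltngtP => [ij|ji|/val_inj ->]; rewrite ?eqxx ?mulVf //.
- have := max_j i; rewrite leqNgt ji implybF negbK => /eqP->.
  by rewrite mul0r; case: eqP ji => // ->; rewrite ltnn.
- by rewrite divff.
Qed.

Lemma f_map_top B Y g r x j : x != 0 -> is_top B x j ->
  f_map B Y g r x = f_piece B Y g r j x.
Proof.
rewrite /f_map => /negPf-> top_j.
case: pickP => [i /is_top_inj/(_ top_j)->// | ].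
by move/(_ j); rewrite top_j.
Qed.

Lemma f_map0 B Y g r : f_map B Y g r 0 = 0.
Proof. by rewrite /f_map eqxx. Qed.

(** A nonzero scalar c changes neither the top index nor the normalized vector, so only the factor
    raised to the power r sees c. *)
Lemma f_map_homogeneous W B Y g r :
    basis_of {:L} W -> dual_basis W B -> (0 < r)%N ->
  homogeneous_map r (f_map B Y g r).
Proof.
move=> W_basis B_dual r_gt0 c x.
(* Here r > 0 matters, since [0 ^+ 0] is 1. *)
have [->|nz_c] := eqVneq c 0.
  by rewrite scale0r f_map0 expr0n gtn_eqF ?scale0r.
have [->|nz_x] := eqVneq x 0; first by rewrite scaler0 f_map0 scaler0.
have [j top_j] := is_top_exists (trace_coords_neq0 W_basis B_dual nz_x).
have top_cj : is_top B (c *: x) j by rewrite is_topZ.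
rewrite (f_map_top _ _ _ nz_x top_j) (f_map_top _ _ _ _ top_cj);
  last by rewrite scaler_eq0 negb_or nz_c.
rewrite /f_piece !normalizedE // trace_coordsZ -scalerAr FtraceZ exprMn -scalerA.
by rewrite mxE invfM [c^-1 * _]mulrC -scalerA scalerK.
Qed.

Lemma eval_vec_neq0 g gbar (u : 'rV[F]_n) : induces g gbar -> u != 0 -> eval_vec g u != 0.
Proof. by move=> g_gbar nz_u; have [[w nz_w] /= <-] := g_gbar (exist _ u nz_u). Qed.

(** Proportional values of g are one point of the projective space, and [gbar] is injective on
    points. *)
Lemma eval_vec_proportional g gbar (u v : 'rV[F]_n) (c : F) :
    induces g gbar -> injective gbar -> u != 0 -> v != 0 -> c != 0 ->
  eval_vec g u = c *: eval_vec g v -> exists2 d : F, d != 0 & u = d *: v.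
Proof.
move=> g_gbar inj_gbar nz_u nz_v nz_c eq_uv.
have [w Dw gbar_u] := g_gbar (exist _ u nz_u).
have [w' Dw' gbar_v] := g_gbar (exist _ v nz_v).
have /inj_gbar/eqP: gbar (\pi_(PG F n) (exist _ u nz_u)) =
                    gbar (\pi_(PG F n) (exist _ v nz_v)).
  rewrite gbar_u gbar_v; apply/eqP; rewrite eqmodE; apply/existsP; exists c.
  by rewrite nz_c Dw Dw' /= eq_uv eqxx.
by rewrite eqmodE => /existsP[d /andP[nz_d /eqP]]; exists d.
Qed.

Lemma f_pieceE B Y g r x j : is_top B x j ->
  f_piece B Y g r j x =
    \sum_k (trace_coords B x 0 j ^+ r *:
              eval_vec g ((trace_coords B x 0 j)^-1 *: trace_coords B x)) 0 k *: tnth Y k.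
Proof.
move=> top_j; rewrite /f_piece normalizedE // scaler_sumr.
by apply: eq_bigr => k _; rewrite scalerA !mxE.
Qed.

Lemma basis_sum_inj Y (u v : 'rV[F]_n) : basis_of {:L} Y ->
  \sum_k u 0 k *: tnth Y k = \sum_k v 0 k *: tnth Y k -> u = v.
Proof.
move=> Y_basis eq_uv; apply/rowP=> k.
have E (z : 'rV[F]_n) : coord Y k (\sum_k z 0 k *: tnth Y k) = z 0 k.
  under eq_bigr => i _ do rewrite (tnth_nth 0).
  by rewrite coord_sum_free ?(basis_free Y_basis).
by rewrite -E eq_uv E.
Qed.

Lemma f_map_inj W B Y g gbar r :
    basis_of {:L} W -> basis_of {:L} Y -> dual_basis W B ->
    induces g gbar -> injective gbar -> (0 < r)%N -> coprime r (#|F| - 1) ->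
  injective (f_map B Y g r).
Proof.
move=> W_basis Y_basis B_dual g_gbar inj_gbar r_gt0 co_r.
have nz_coords := trace_coords_neq0 W_basis B_dual.
(* Zero has no projective point, so it is treated apart: g has no nonzero common root, hence f
   vanishes only at 0. *)
have f_eq0 x : f_map B Y g r x = 0 -> x = 0.
  apply: contra_eq => nz_x; have [j top_j] := is_top_exists (nz_coords x nz_x).
  have nz_j := is_top_neq0 top_j.
  have sum0: \sum_k (0 : 'rV[F]_n) 0 k *: tnth Y k = 0.
    by rewrite big1 // => k _; rewrite mxE scale0r.
  rewrite (f_map_top _ _ _ nz_x top_j) f_pieceE //; apply/eqP=> f0.
  move/eqP: (basis_sum_inj Y_basis (etrans f0 (esym sum0))); apply/negP.
  rewrite scaler_eq0 negb_or expf_neq0 // (eval_vec_neq0 g_gbar) //.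
  by rewrite scaler_eq0 negb_or invr_eq0 nz_j nz_coords.
move=> x y eq_fxy.
have [x0|nz_x] := eqVneq x 0.
  by rewrite x0; apply/esym/f_eq0; rewrite -eq_fxy x0 f_map0.
have [y0|nz_y] := eqVneq y 0.
  by rewrite y0; apply/f_eq0; rewrite eq_fxy y0 f_map0.
have [i top_i] := is_top_exists (nz_coords x nz_x).
have [j top_j] := is_top_exists (nz_coords y nz_y).
have [nz_i nz_j] := (is_top_neq0 top_i, is_top_neq0 top_j).
move: eq_fxy.
rewrite (f_map_top _ _ _ nz_x top_i) (f_map_top _ _ _ nz_y top_j) !f_pieceE //.
move/(basis_sum_inj Y_basis).
set a := trace_coords B x 0 i in nz_i *; set b := trace_coords B y 0 j in nz_j *.
set u := a^-1 *: _; set v := b^-1 *: _ => eq_uv.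
have nz_u : u != 0 by rewrite scaler_eq0 negb_or invr_eq0 nz_i nz_coords.
have nz_v : v != 0 by rewrite scaler_eq0 negb_or invr_eq0 nz_j nz_coords.
(* The factor comes from [eq_uv], which reads a^r g(u) = b^r g(v). *)
have nz_ab : b ^+ r / a ^+ r != 0 by rewrite mulf_neq0 ?invr_eq0 ?expf_neq0.
have [] := eval_vec_proportional g_gbar inj_gbar nz_u nz_v nz_ab.
  by rewrite mulrC -scalerA -eq_uv scalerA mulVf ?expf_neq0 ?scale1r.
move=> d nz_d Du.
have Dx : x = (a * d / b) *: y.
  apply: (trace_coords_inj W_basis B_dual).
  by rewrite trace_coordsZ -2!scalerA -/v -Du scalerA divff ?scale1r.
(* Proportional elements have the same top index. *)
have eq_ij : i = j.
  by apply: is_top_inj top_j; rewrite -(@is_topZ _ (a * d / b)) ?mulf_neq0 ?invr_eq0 // -Dx.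
(* Both vectors have entry 1 at the common top index, which forces d = 1. *)
have uv : u = v.
  have Dui : u 0 j = 1 by rewrite -eq_ij mxE mulVf.
  have Dvj : v 0 j = 1 by rewrite mxE mulVf.
  by move: Dui; rewrite Du mxE Dvj mulr1 => ->; rewrite scale1r.
(* As g(v) is nonzero, it cancels from [eq_uv], leaving a^r = b^r. *)
have eq_ab : a = b.
  apply: (expf_coprime_inj r_gt0 co_r) => //; apply/eqP; rewrite -subr_eq0.
  move/eqP: eq_uv; rewrite uv -subr_eq0 -scalerBl scaler_eq0.
  by rewrite [_ g v == 0](negPf (eval_vec_neq0 g_gbar nz_v)) orbF.
apply: (trace_coords_inj W_basis B_dual).
by rewrite -[LHS](scalerKV nz_i) -[RHS](scalerKV nz_j) -/u -/v uv eq_ab.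
Qed.

End Trace.

(** * Polynomial expressions for maps on [L] *)

Lemma finite_ext_poly (F : finFieldType) (L : splittingFieldType F)
    (u w : L -> L) :
    (forall x y, x != 0 -> y != 0 -> u x = u y -> w x = w y) ->
  exists p : {poly L}, forall x, x != 0 -> p.[u x] = w x.
Proof.
(* [finvect_type L] supplies the finite enumeration of [L]; the nonzero elements index the nodes. *)
move=> w_u; pose s : seq L := [seq x <- enum (finvect_type L) | x != 0].
have [|p Dp] := @poly_interpolation L L s u w; last first.
  by exists p => x nz_x; apply: Dp; rewrite mem_filter nz_x (mem_enum (finvect_type L)).
by move=> x y; rewrite !mem_filter => /andP[nz_x _] /andP[nz_y _]; apply: w_u.
Qed.

Lemma homogeneous_polynomial (F : finFieldType) (L : splittingFieldType F)
    (r : nat) (f : L -> L) :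
    (0 < r)%N -> homogeneous_map r f ->
  exists h : {poly L}, forall x, f x = x ^+ r * h.[x ^+ (#|F| - 1)].
Proof.
move=> r_gt0 f_hom.
have [x y nz_x nz_y eq_xy | h Dh] :=
  @finite_ext_poly F L (fun x => x ^+ (#|F| - 1)) (fun x => f x / x ^+ r).
  (* The quotient z = x / y satisfies z^(q-1) = 1, so z^q = z, which characterizes the copy [1%VS]
     of [F]. *)
  have /vlineP[c Dc]: x / y \in 1%VS.
    rewrite Fermat's_little_theorem dimv1 expn1.
    rewrite -(subnK (ltnW (finNzRing_gt1 F))) exprD expr1.
    by rewrite expr_div_n eq_xy divff ?mul1r // expf_neq0.
  have Dx : x = c *: y by rewrite -[c *: y]mulr_algl -Dc divfK.
  have nz_c : c ^+ r != 0.
    by rewrite expf_neq0 //; apply: contra_neq nz_x => c0; rewrite Dx c0 scale0r.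
  rewrite Dx f_hom exprZn invrZ ?unitfE ?(expf_neq0 _ nz_y) //.
  by rewrite -scalerAr -scalerAl scalerK.
(* At 0 both sides vanish because r > 0, whatever the value of [h]. *)
exists h => x; have [->|nz_x] := eqVneq x 0; last by rewrite Dh // mulrC divfK ?expf_neq0.
by rewrite -[X in f X](scale0r 0) f_hom !expr0n gtn_eqF // scale0r mul0r.
Qed.

Theorem theorem3p2 (q n : nat) (F : finFieldType) (L : splittingFieldType F)
  (W Y B : n.-tuple L) (g : 'I_n -> {mpoly F[n]}) (gbar : PG F n -> PG F n)
  (r : nat)
  (card_F : #|F| = q) (n_ge2 : (2 <= n)%N) (dim_L : \dim {:L} = n)
  (W_basis : basis_of {:L} W) (Y_basis : basis_of {:L} Y)
  (B_dual : dual_basis W B)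
  (g_gbar : induces g gbar) (gbar_bij : bijective gbar)
  (r_gt0 : (0 < r)%N) (r_coprime : coprime r (q - 1)) :
  let f := f_map B Y g r in
  [/\ homogeneous_map r f, rational_mapping B f, bijective f &
      (\max_(k < n) (msize (g k)).-1 <= r)%N ->
        homogeneous_map r f /\ index_perm_poly r f].
Proof.
rewrite -{q}card_F in r_coprime * => f.
have f_hom : homogeneous_map r f by apply: (f_map_homogeneous _ _ W_basis B_dual).
have f_bij : bijective f.
  apply: (@injF_bij (finvect_type L)).
  exact: (f_map_inj W_basis Y_basis B_dual g_gbar (bij_inj gbar_bij)).
split=> // [j | _].
  (* Every map on a finite field is polynomial, so the denominator can be 1. *)
  have [p Dp] := @finite_ext_poly F L id f (fun x y _ _ => congr1 f (x := x) (y := y)).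
  exists p, 1 => x top_j; rewrite hornerC oner_eq0 divr1; split=> //.
  (* The interpolation covers nonzero x only; [is_top] excludes 0, whose traces all vanish. *)
  rewrite Dp //; apply: contraTneq top_j => ->.
  by rewrite /is_top -(scale0r 0) -scalerAr FtraceZ mul0r eqxx.
by split=> //; split=> //; apply: homogeneous_polynomial.
Qed.
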